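(* Let $p$ be a prime and let $q=p^\alpha$ with $\alpha>0$ an integer. Let $k\geq 2$ be an integer. Let $L\subseteq\{0,1,\ldots,q-1\}$ be a proper subset with $|L|=s>0$. Let $n$ be a positive integer and let $\mathcal F\subseteq 2^{[n]}$ be a family of subsets of $[n]$ such that for every $F\in\mathcal F$, $|F|\not\equiv \ell\pmod q$ for all $\ell\in L$, and such that for any $k$ distinct sets $F_1,\ldots,F_k\in\mathcal F$ there exists $\ell\in L$ with $|F_1\cap\cdots\cap F_k|\equiv \ell\pmod q$. Suppose moreover that there is an integer $t\leq q-1$ such that for each $F\in\mathcal F$, $|F|\equiv r\pmod q$ for some $r\in\{q-t,\ldots,q-1\}$. Then $$|\mathcal F|\leq (k-1)\sum_{j=q-t}^{q-1}\binom{n}{j}.$$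
   Context: $2^{[n]}$ denotes the family of all subsets of $[n]=\{1,\ldots,n\}$. *)

(* Defs.v *)
From mathcomp Require Export all_boot all_order all_algebra.
Set Implicit Arguments.
Unset Strict Implicit.
Unset Printing Implicit Defensive.

(* Main.v *)
Require Import Defs.
From mathcomp Require Import all_boot all_order all_algebra.
From mathcomp Require Import zify.

(** Greedily split [F] into blocks [D] of fewer than [k] sets, choosing [D]
    maximal among those whose intersection [B] has size outside [L] modulo [q];
    then [#|B :&: A|] lies in [L] modulo [q] for every later set [A].  Over
    ['F_p], the function [A |-> 'C(#|B :&: A| - #|B| - 1, q - 1)] is nonzero
    exactly when [#|B :&: A| = #|B| %[mod q]], so the functions attached to the
    blocks form a triangular system and are independent on [F].  They are
    combinations of the indicators [J \subset A] with [#|J| < q], and the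
    assumption on the residues of the sizes allows eliminating, on [F], the
    indicators with [#|J| < q - t].  Hence there are at most
    ['C(n, q - t) + ... + 'C(n, q - 1)] blocks. *)

Import GRing.Theory.

(** Otherwise ['C(p ^ e, i)] is coprime to [p ^ e], and [i * 'C(p ^ e, i) = p ^ e * 'C((p ^ e).-1,
    i.-1)] forces [p ^ e] to divide [i]. *)
Lemma prime_dvd_bin_pexp (p e i : nat) :
  prime p -> 0 < i < p ^ e -> p %| 'C(p ^ e, i).
Proof.
case: i => // i pr_p /= lt_iq; apply: contraLR lt_iq => pNbin.
rewrite -leqNgt; apply: dvdn_leq => //.
have cop : coprime (p ^ e) 'C(p ^ e, i.+1) by rewrite coprimeXl // prime_coprime.
by rewrite -(Gauss_dvdl i.+1 cop) -mul_bin_diag dvdn_mulr.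
Qed.

(** Copies of [p ^ e] are removed from [m] one by one: in the Vandermonde expansion only the term
    taking nothing from the removed copy survives modulo [p]. *)
Lemma bin_modn_pexp (p e m j : nat) :
  prime p -> j < p ^ e -> 'C(m, j) = 'C(m %% p ^ e, j) %[mod p].
Proof.
move=> pr_p lt_jq; rewrite {1}(divn_eq m (p ^ e)).
elim: (m %/ _) => [|b IHb]; first by rewrite mul0n add0n.
rewrite mulSn -addnA -IHb -binomial.Vandermonde big_ord_recl bin0 mul1n subn0.
rewrite -[X in _ = X %% _]addn0; apply/eqP; rewrite eqn_modDl mod0n -/(dvdn _ _).
apply: dvdn_sum => i _; apply/dvdn_mulr/prime_dvd_bin_pexp => //.
by rewrite /= /bump /=; have := ltn_ord i; lia.
Qed.

Lemma natr_bin_modn (p e m j : nat) : prime p -> j < p ^ e ->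
  ('C(m, j)%:R = 'C(m %% p ^ e, j)%:R :> 'F_p)%R.
Proof.
move=> pr_p lt_jq; rewrite -(Fp_nat_mod pr_p) (bin_modn_pexp _ _ _ _ pr_p lt_jq).
exact: Fp_nat_mod.
Qed.

Lemma natr_bin_pexp_pred (p e m : nat) : prime p ->
  ('C(m, (p ^ e).-1)%:R = (m %% p ^ e == (p ^ e).-1)%N%:R :> 'F_p)%R.
Proof.
move=> pr_p; have q_gt0 : 0 < p ^ e by rewrite expn_gt0 prime_gt0.
rewrite (natr_bin_modn _ e) //; last by rewrite prednK.
have [->|neq] := eqVneq; first by rewrite binn.
by rewrite bin_small //; have := ltn_pmod m q_gt0; lia.
Qed.

Lemma big_card_range (R : Type) (idx : R) (op : Monoid.com_law idx)
    (T : finType) (a b : nat) (G : {set T} -> R) :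
  \big[op/idx]_(J : {set T} | a <= #|J| < b) G J
    = \big[op/idx]_(a <= j < b) \big[op/idx]_(J : {set T} | #|J| == j) G J.
Proof.
rewrite (exchange_big_dep xpredT) //= big_mkcond /=; apply: eq_bigr => J _.
by under eq_bigl do rewrite eq_sym; rewrite big_nat1_eq.
Qed.

Lemma exists_triangular_bin (R : pzRingType) (i a b : nat) : i <= a ->
  exists c : nat -> R, forall r, a <= r < b ->
    (\sum_(a <= j < b) c j * ('C(r - i, j - i))%:R = 1)%R.
Proof.
move=> le_ia; elim: b => [|b [c IHb]]; first by exists (fun=> 0%R) => r; lia.
(* Row [r = b] forces this value, its diagonal entry being 1; rows [r < b] have entry 0 in column
   [b], so the earlier equations persist. *)
pose d := (1 - \sum_(a <= j < b) c j * ('C(b - i, j - i))%:R)%R.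
exists (fun j => if j == b then d else c j) => r /andP[le_ar lt_rb].
have le_ab : a <= b by lia.
rewrite big_nat_recr //= eqxx.
under eq_big_nat => j /andP[_ lt_jb] do rewrite (ltn_eqF lt_jb).
have [->|neq_rb] := eqVneq r b; first by rewrite binn mulr1 addrC subrK.
by rewrite [in X in (_ + X)%R]bin_small ?mulr0 ?addr0 ?IHb //; lia.
Qed.

(** Removing [I] is a bijection onto the subsets of [A :\: I] of size [j - #|I|], with inverse
    [K |-> I :|: K]. *)
Lemma card_subset_interval (T : finType) (I A : {set T}) (j : nat) :
  I \subset A -> #|I| <= j ->
  #|[set J : {set T} | [&& I \subset J, J \subset A & #|J| == j]]|
    = 'C(#|A| - #|I|, j - #|I|).
Proof.
move=> sIA le_Ij.
have -> : #|A| - #|I| = #|A :\: I| by rewrite cardsDS.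
rewrite -cards_draws -(@card_in_imset _ _ (fun J => J :\: I)); last first.
  move=> J K; rewrite !inE => /and3P[sIJ _ _] /and3P[sIK _ _] eqJK.
  by rewrite -(setID J I) -(setID K I) eqJK !(setIidPr _).
apply: eq_card => K; rewrite !inE; apply/imsetP/andP.
  case=> J; rewrite inE => /and3P[sIJ sJA /eqP cJ] ->.
  by rewrite setSD // cardsDS // cJ.
case=> sKA /eqP cK; have dKI : K :&: I = set0.
  by apply/eqP; rewrite setI_eq0; move: sKA; rewrite subsetD => /andP[].
exists (I :|: K); last by rewrite setDUl setDv set0U; apply/esym/setDidPl; rewrite -setI_eq0 dKI.
rewrite inE subsetUl subUset sIA (subset_trans sKA (subsetDl _ _)) /=.
by rewrite cardsU setIC dKI cards0 subn0 cK subnKC.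
Qed.

(* [D] is maximal among the subfamilies with fewer than [k] members whose
   intersection violates [P]; it is discarded as a whole at each step. *)
Lemma exists_triangular_pairs (n k : nat) (P : pred nat) (F : {set {set 'I_n}}) :
  1 < k ->
  (forall A, A \in F -> ~~ P #|A|) ->
  (forall D : {set {set 'I_n}}, D \subset F -> #|D| = k ->
     P #|\bigcap_(A in D) A|) ->
  exists m (A B : nat -> {set 'I_n}),
    [/\ #|F| <= (k - 1) * m,
        forall i, i < m -> A i \in F,
        forall i, i < m -> B i \subset A i /\ ~~ P #|B i| &
        forall i j, i < j < m -> P #|B i :&: A j|].
Proof.
move=> k_gt1; have [b] := ubnP #|F|; elim: b F => // b IHb F lt_Fb PF PD.
have [->|/set0Pn[A0 A0F]] := eqVneq F set0.
  by exists 0, (fun=> set0), (fun=> set0); split; rewrite ?cards0 // => i; lia.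
(* Requiring [A0 \in D] makes the block nonempty, so [F :\: D] is smaller, and puts the intersection
   inside [A0]. *)
pose good (D : {set {set 'I_n}}) :=
  [&& D \subset F, A0 \in D, #|D| < k & ~~ P #|\bigcap_(A in D) A|].
have good1 : good [set A0].
  by rewrite /good sub1set A0F set11 cards1 k_gt1 big_set1 PF.
have [D /maxsetP[/and4P[sDF A0D lt_Dk PND] maxD] _] := maxset_exists good1.
have D_gt0 : 0 < #|D| by rewrite card_gt0; apply/set0Pn; exists A0.
have cFD := cardsDS sDF; have leDF := subset_leq_card sDF.
have [|||m [A [B [le_m AF BA BP]]]] := IHb (F :\: D).
- lia.
- by move=> A /setDP[AF _]; exact: PF.
- by move=> E sE; apply: PD; apply: subset_trans sE (subsetDl _ _).
exists m.+1, (fun i => if i is i'.+1 then A i' else A0),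
  (fun i => if i is i'.+1 then B i' else \bigcap_(A in D) A).
split.
- by move: le_m; rewrite cFD mulnS; lia.
- by case=> [|i] // lt_im; have /setDP[] := AF i lt_im.
- by case=> [|i] lt_im; [split=> //; exact: bigcap_inf | exact: BA].
case=> [|i] [|j] //; last exact: BP.
move=> /= lt_jm; have /setDP[AjF AjND] := AF j lt_jm.
have -> : \bigcap_(C in D) C :&: A j = \bigcap_(C in A j |: D) C.
  by rewrite big_setU1 //= setIC.
have cU : #|A j |: D| = #|D|.+1 by rewrite cardsU1 AjND.
have sUF : A j |: D \subset F by rewrite subUset sub1set AjF.
(* With [k] sets the hypothesis on [k]-fold intersections applies; with fewer, failure of [P] would
   contradict the maximality of [D]. *)
have [eqk|neqk] := eqVneq #|D|.+1 k; first by apply: PD; rewrite ?cU.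
apply: contraNT AjND => PNU.
rewrite -(maxD (A j |: D) _ (subsetUr _ _)) ?setU11 //.
by rewrite /good sUF inE A0D orbT cU PNU andbT; lia.
Qed.

(** Equality is asked only on [F]: this is what lets the residue condition eliminate small [J]. *)
Definition inclusion_spanned {R : pzRingType} {n : nat} (F S : {set {set 'I_n}})
    (g : {set 'I_n} -> R) : Prop :=
  exists c : {set 'I_n} -> R, forall A, A \in F ->
    g A = (\sum_(J in S) c J * (J \subset A)%:R)%R.

Section InclusionSpan.
Local Open Scope ring_scope.
Variables (R : pzRingType) (n : nat) (F S : {set {set 'I_n}}).

Lemma inclusion_spanned_sum (I : finType) (Q : pred I) (d : I -> R)
    (g : I -> {set 'I_n} -> R) :
  (forall i, Q i -> inclusion_spanned F S (g i)) ->
  inclusion_spanned F S (fun A => \sum_(i | Q i) d i * g i A).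
Proof.
move=> spg.
have /fin_all_exists[c cP] : forall i, exists c : {set 'I_n} -> R,
    Q i -> forall A, A \in F -> g i A = \sum_(J in S) c J * (J \subset A)%:R.
  move=> i; have [/spg[c cP]|_] := boolP (Q i); last by exists (fun=> 0).
  by exists c.
exists (fun J => \sum_(i | Q i) d i * c i J) => A AF.
under [RHS]eq_bigr do rewrite mulr_suml.
rewrite exchange_big; apply: eq_bigr => i Qi /=.
by rewrite (cP i Qi A AF) mulr_sumr; apply: eq_bigr => J _; rewrite mulrA.
Qed.

Lemma eq_inclusion_spanned (g h : {set 'I_n} -> R) :
  {in F, g =1 h} -> inclusion_spanned F S g -> inclusion_spanned F S h.
Proof. by move=> gh [c cP]; exists c => A AF; rewrite -gh // cP. Qed.

End InclusionSpan.

(** The matrix of values [g i (A j)] is triangular and invertible, hence of rank [m], yet it factors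
    through dimension [#|S|]. *)
Lemma leq_inclusion_spanned_triangular (R : fieldType) (n m : nat)
    (F S : {set {set 'I_n}}) (A : nat -> {set 'I_n})
    (g : nat -> {set 'I_n} -> R) :
  (forall i, i < m -> A i \in F) ->
  (forall i, i < m -> inclusion_spanned F S (g i)) ->
  (forall i, i < m -> g i (A i) != 0%R) ->
  (forall i j, i < j < m -> g i (A j) = 0%R) ->
  m <= #|S|.
Proof.
move=> AF spg g_diag g_trig.
have /fin_all_exists[c cP] : forall i : 'I_m, exists c : {set 'I_n} -> R,
    forall B, B \in F -> (g i B = \sum_(J in S) c J * (J \subset B)%:R)%R.
  by move=> i; exact: spg.
pose M := (\matrix_(i < m, j < m) g i (A j))%R.
pose C := (\matrix_(i < m, j < #|S|) c i (enum_val j))%R.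
pose X := (\matrix_(i < #|S|, j < m) (enum_val i \subset A j)%:R : 'M[R]_(_, _))%R.
have defM : M = (C *m X)%R.
  apply/matrixP => i j; rewrite !mxE cP ?AF // big_enum_val.
  by apply: eq_bigr => l _; rewrite !mxE.
have trigM : is_trig_mx M.
  by apply/is_trig_mxP => i j lt_ij; rewrite mxE g_trig // lt_ij /=.
have unitM : M \in unitmx.
  rewrite unitmxE unitfE det_trig //; apply/prodf_neq0 => i _.
  by rewrite mxE g_diag.
by rewrite -(mxrank_unit unitM) defM mulmx_max_rank.
Qed.

Section PrimePower.
Variables (p e n a : nat) (F : {set {set 'I_n}}).
Hypothesis pr_p : prime p.
Hypothesis leaF : forall A, A \in F -> a <= #|A| %% p ^ e.
Local Notation q := (p ^ e).
Local Notation layers := [set J : {set 'I_n} | a <= #|J| < q].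

(* On [F] the sum over [J] of size [j] containing [I] of [J \subset A] is
   [(I \subset A) * 'C(#|A| - #|I|, j - #|I|)], which modulo [p] only depends on
   the residue of [#|A|] modulo [q]; the resulting system is unitriangular. *)
Lemma inclusion_spanned_layers (I : {set 'I_n}) : #|I| < q ->
  inclusion_spanned F layers (fun A => (I \subset A)%:R : 'F_p)%R.
Proof.
move=> lt_Iq; have [le_aI|lt_Ia] := leqP a #|I|.
  exists (fun J => (J == I)%:R)%R => A _.
  rewrite (bigD1 I) ?inE ?le_aI //= eqxx mul1r big1 ?addr0 // => J.
  by case/andP=> _ /negPf->; rewrite mul0r.
have [c cP] := exists_triangular_bin 'F_p #|I| a q (ltnW lt_Ia).
exists (fun J : {set 'I_n} => (I \subset J)%:R * c #|J|)%R => A AF.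
under eq_bigl do rewrite inE.
rewrite big_card_range; have [sIA|NsIA] := boolP (I \subset A); last first.
  rewrite big1 // => j _; rewrite big1 // => J _.
  have [sIJ|_] := boolP (I \subset J); last by rewrite !mul0r.
  rewrite (_ : J \subset A = false) ?mulr0 //; apply: contraNF NsIA.
  exact: subset_trans.
have q_gt0 : 0 < q by rewrite expn_gt0 prime_gt0.
rewrite -[LHS](cP (#|A| %% q)) ?leaF ?ltn_pmod //.
apply: eq_big_nat => j /andP[le_aj lt_jq].
(* No borrow occurs, since [#|I| < a <= #|A| %% q]. *)
have -> : #|A| %% q - #|I| = (#|A| - #|I|) %% q.
  have le_r := leaF A AF; have lt_r := ltn_pmod #|A| q_gt0.
  rewrite [X in _ = (X - _) %% _](divn_eq #|A| q) -addnBA; last exact: leq_trans (ltnW lt_Ia) le_r.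
  by rewrite modnMDl [RHS]modn_small // (leq_ltn_trans (leq_subr _ _) lt_r).
rewrite -natr_bin_modn //; last by lia.
rewrite -card_subset_interval //; last by lia.
rewrite -sum1_card natr_sum mulr_sumr big_mkcond [RHS]big_mkcond /=.
apply: eq_bigr => J _; rewrite inE.
by case: eqP => [->|_]; case: (I \subset J); case: (J \subset A);
  rewrite /= ?mul0r ?mul1r ?mulr0.
Qed.

(** Vandermonde leaves the factors ['C(#|B :&: A|, i)] with [i < q], each counting the [i]-sets [I]
    contained in both [B] and [A]. *)
Lemma inclusion_spanned_bin (B : {set 'I_n}) (c : nat) :
  inclusion_spanned F layers
    (fun A => ('C(#|B :&: A| + c, q.-1))%:R : 'F_p)%R.
Proof.
have q_gt0 : 0 < q by rewrite expn_gt0 prime_gt0.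
pose d (I : {set 'I_n}) : 'F_p := ((I \subset B)%:R * ('C(c, q.-1 - #|I|))%:R)%R.
have := inclusion_spanned_sum 'F_p n F layers {set 'I_n}
  (fun I => 0 <= #|I| < q) d (fun I A => (I \subset A)%:R)%R
  inclusion_spanned_layers.
apply: eq_inclusion_spanned => A _.
rewrite big_card_range -binomial.Vandermonde natr_sum prednK // big_mkord.
apply: eq_bigr => i _; rewrite -cards_draws -sum1_card natrM natr_sum mulr_suml.
rewrite big_mkcond [RHS]big_mkcond /=; apply: eq_bigr => I _.
rewrite /d inE subsetI; case: eqP => [->|_]; last by rewrite andbF.
by case: (I \subset B); case: (I \subset A);
  rewrite /= ?mul0r ?mul1r ?mulr0 ?mulr1.
Qed.

End PrimePower.

Lemma card_layers (n a b : nat) :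
  #|[set J : {set 'I_n} | a <= #|J| < b]| = \sum_(a <= j < b) 'C(n, j).
Proof.
rewrite -sum1_card; under eq_bigl do rewrite inE.
rewrite big_card_range; apply: eq_bigr => j _.
rewrite -[in RHS](card_ord n) -card_draws -sum1_card.
by apply: eq_bigl => J; rewrite inE.
Qed.

Theorem theorem1p7 (p alpha q k s n : nat) (L : {set 'I_q})
    (F : {set {set 'I_n}}) (t : int)
    (p_prime : prime p) (alpha_gt0 : 0 < alpha) (q_def : q = p ^ alpha)
    (k_ge2 : 2 <= k)
    (L_proper : L \proper [set: 'I_q]) (L_card : #|L| = s) (s_gt0 : 0 < s)
    (n_gt0 : 0 < n)
    (F_sizes : forall A : {set 'I_n}, A \in F ->
       forall l : 'I_q, l \in L -> #|A| <> l %[mod q])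
    (F_inter : forall A : 'I_k -> {set 'I_n}, injective A ->
       (forall i : 'I_k, A i \in F) ->
       exists2 l : 'I_q, l \in L & #|\bigcap_(i < k) A i| = l %[mod q])
    (t_le : (t <= q%:Z - 1)%R)
    (F_residues : forall A : {set 'I_n}, A \in F ->
       exists2 r : nat, (q%:Z - t <= r%:Z)%R && (r%:Z <= q%:Z - 1)%R
                      & #|A| = r %[mod q]) :
  #|F| <= (k - 1) * \sum_(0 <= j < q | (q%:Z - t <= j%:Z)%R) 'C(n, j).

Proof.
pose P m := [exists l in L, m == l %[mod q]].
have q_gt0 : 0 < q by rewrite q_def expn_gt0 prime_gt0.
(* The bound on [t] makes [q - t] positive, so the absolute value loses nothing. *)
pose a := absz (q%:Z - t)%R.
have aE : (q%:Z - t = a%:Z)%R by rewrite /a; lia.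
have PF A : A \in F -> ~~ P #|A|.
  by move=> AF; apply/exists_inP => -[l lL /eqP]; exact: F_sizes.
have PD (D : {set {set 'I_n}}) : D \subset F -> #|D| = k -> P #|\bigcap_(A in D) A|.
  move=> sDF cD; move: F_inter; rewrite -cD => /(_ enum_val) [||l lL eq_l].
  - exact: enum_val_inj.
  - by move=> i; apply: (subsetP sDF); exact: enum_valP.
  by apply/exists_inP; exists l; rewrite // big_enum_val; apply/eqP.
have leaF A : A \in F -> a <= #|A| %% p ^ alpha.
  rewrite -q_def => /F_residues[r /andP[]]; rewrite aE => le_ar lt_rq ->.
  by rewrite modn_small; lia.
have [m [A [B [le_Fm AF BA BP]]]] := exists_triangular_pairs _ _ P F k_ge2 PF PD.
apply: leq_trans le_Fm _; rewrite leq_mul2l; apply/orP; right.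
have -> : \sum_(0 <= j < q | (q%:Z - t <= j%:Z)%R) 'C(n, j)
    = #|[set J : {set 'I_n} | a <= #|J| < p ^ alpha]|.
  rewrite card_layers -q_def aE (big_nat_widenl a 0) //=.
(* [#|B i|.+1 * q.-1] is a natural number congruent to [- #|B i| - 1] modulo [q]. *)
pose g i (C : {set 'I_n}) : 'F_p :=
  ('C(#|B i :&: C| + #|B i|.+1 * q.-1, q.-1))%:R%R.
have gE i C : g i C = (#|B i :&: C| == #|B i| %[mod q])%:R%R.
  rewrite /g q_def natr_bin_pexp_pred // -q_def; congr (nat_of_bool _)%:R%R.
  rewrite -[X in _ == X](@modn_small _ q); last by rewrite prednK.
  (* Adding [#|B i|.+1] to both sides turns the shift into a multiple of [q] and [q.-1] into
     [q + #|B i|]. *)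
  rewrite -(eqn_modDr #|B i|.+1) -addnA -mulnSr prednK // [X in X == _ %[mod _]]addnC modnMDl.
  by rewrite addnS -addSn prednK // modnDl.
apply: (leq_inclusion_spanned_triangular _ n m F _ A g) => //.
- by move=> i _; rewrite /g q_def; exact: inclusion_spanned_bin.
- by move=> i /BA[/setIidPl BAi _]; rewrite gE BAi eqxx oner_eq0.
move=> i j /[dup] /andP[lt_ij lt_jm] /BP /exists_inP[l lL /eqP eq_l].
have /BA[_ /negP PNB] := ltn_trans lt_ij lt_jm.
rewrite gE; case: eqP => // eq_BA; case: PNB; apply/exists_inP.
by exists l; rewrite // -eq_BA eq_l.
Qed.
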